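(* Let $A\in\mathbb{Z}^{m\times n}$, $b\in\mathbb{Z}^m$, $\mathcal{P}=\{x\in\mathbb{R}^n_{\ge0}: Ax=b\}$ and $\mathcal{P}_I=\operatorname{Conv}(\mathcal{P}\cap\mathbb{Z}^n)$. For each vertex $v$ of $\mathcal{P}_I$ with $s=|\operatorname{supp}(v)|$ we have \[ |\operatorname{supp}(v)| \le m\cdot\log(2e\Gamma/m+2e), \qquad \Gamma = 1.12\sum_{j=1}^m\lVert a^{(j)}\rVert_2 + \sqrt{\textstyle\sum_{i=1}^s\lVert A_i\rVert_1^2}, \] where $A_1,\ldots,A_s$ are the columns and $a^{(1)},\ldots,a^{(m)}$ are the rows of the submatrix $A[\operatorname{supp}(v)]$, and $e=\exp(1)$.
   Context: All logarithms are base 2. $\operatorname{supp}(v)=\{i: v_i\neq 0\}$; for an index set $I$, $A[I]$ is the submatrix of $A$ consisting of the columns indexed by $I$. A vertex of $\mathcal{P}_I$ is a point $v\in\mathcal{P}_I$ with $v\notin\operatorname{Conv}(\mathcal{P}_I\setminus\{v\})$. *)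

(* Defs.v *)
From HB Require Import structures.
From mathcomp Require Export all_boot all_order all_algebra.
From mathcomp Require Export classical_sets reals sequences exp.

Set Implicit Arguments.
Unset Strict Implicit.
Unset Printing Implicit Defensive.

Import Order.TTheory GRing.Theory Num.Theory.
Local Open Scope classical_set_scope.
Local Open Scope ring_scope.

Definition log2 (R : realType) (x : R) : R := ln x / ln 2.

(* Entrywise, only applied to rows and columns; the library norm on matrices is
   the sup norm. *)
Definition norm1 (R : realType) (p q : nat) (u : 'M[R]_(p, q)) : R :=
  \sum_i \sum_j `|u i j|.

Definition norm2 (R : realType) (p q : nat) (u : 'M[R]_(p, q)) : R :=
  Num.sqrt (\sum_i \sum_j u i j ^+ 2).

Definition supp (R : realType) (n : nat) (v : 'cV[R]_n) : {set 'I_n} :=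
  [set i | v i ord0 != 0]%SET.

(* A[I]; enum_val lists the elements of I in increasing order. *)
Definition colsubset (T : Type) (m n : nat) (A : 'M[T]_(m, n))
    (I : {set 'I_n}) : 'M[T]_(m, #|I|) :=
  colsub (fun k : 'I_#|I| => enum_val k) A.

Definition conv (R : realType) (n : nat) (X : set 'cV[R]_n) : set 'cV[R]_n :=
  [set x | exists (k : nat) (c : 'I_k -> R) (y : 'I_k -> 'cV[R]_n),
     [/\ forall i, 0 <= c i, \sum_i c i = 1, forall i, X (y i)
       & x = \sum_i c i *: y i]].

Definition polyhedron (R : realType) (m n : nat)
    (A : 'M[int]_(m, n)) (b : 'cV[int]_m) : set 'cV[R]_n :=
  [set x : 'cV[R]_n | (forall i, 0 <= x i ord0) /\ map_mx intr A *m x = map_mx intr b].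

Definition integer_points (R : realType) (n : nat) : set 'cV[R]_n :=
  [set x : 'cV[R]_n | forall i, x i ord0 \is a Num.int].

Definition integer_hull (R : realType) (m n : nat)
    (A : 'M[int]_(m, n)) (b : 'cV[int]_m) : set 'cV[R]_n :=
  conv (polyhedron A b `&` @integer_points R n).

Definition is_vertex (R : realType) (n : nat)
    (Q : set 'cV[R]_n) (v : 'cV[R]_n) : Prop :=
  Q v /\ ~ conv (Q `\ v) v.

(* Main.v *)
From mathcomp Require Import boolp ring lra.
Require Import Defs.

Set Implicit Arguments.
Unset Strict Implicit.
Unset Printing Implicit Defensive.

Import Order.TTheory GRing.Theory Num.Theory.
Local Open Scope classical_set_scope.
Local Open Scope ring_scope.

(**
Since v is a vertex it is integral, and the 2^s vectors B x with x in {-1, 1}^s,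
where B = A[supp v], are pairwise distinct points of Z^m.  A uniformly random
sign vector satisfies E |(B x)_j| <= ||a^(j)||_2, so that
E ||B x||_1 <= Gamma.  Gibbs' inequality compares the uniform distribution on
these points with the sub-probability weight
prod_j (1 - r) / 2 * r^|z_j| on Z^m, where mu = Gamma / m and
r = mu / (1 + mu); it yields
s ln 2 <= m (ln (2 (1 + mu)) + mu ln (1 + 1 / mu)) <= m ln (2 e (1 + mu)).
*)

(** * Entropy bound for finite sets of lattice points *)

(** Sum [ln t <= t - 1] at [t = #|T|%:R * q x] over all [x]; the right-hand sides add up to at most
    0. *)
Lemma gibbs_uniform (R : realType) (T : finType) (q : T -> R) :
  (forall x, 0 < q x) -> \sum_x q x <= 1 ->
  #|T|%:R * ln (#|T|%:R : R) <= - \sum_x ln (q x).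
Proof.
move=> q_gt0 sum_q; have [T0|T_gt0] := posnP #|T|.
  by rewrite T0 mul0r big1 ?oppr0// => x _; have := fintype0 x T0.
have N_gt0 : 0 < #|T|%:R :> R by rewrite ltr0n.
have le_term x : ln (#|T|%:R : R) + ln (q x) <= #|T|%:R * q x - 1.
  rewrite -lnM ?posrE//.
  rewrite -[X in ln X](subrKC 1); apply: le_ln1Dx.
  by rewrite ltrBrDl subrr mulr_gt0.
have := ler_sum (index_enum T) (P := xpredT) (fun x _ => le_term x).
rewrite big_split sumrB -mulr_sumr !sumr_const /= -(mulr_natl (ln _)) => H.
rewrite -subr_le0 opprK; apply: le_trans H _.
by rewrite subr_le0 ler_piMr// ltW.
Qed.

(** Encode each coordinate by its sign and its absolute value, the latter truncated at a common
    bound [K]. The encoding is injective, so the sum is at most the sum over all codes, which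
    factors over the coordinates. Each factor is [1 - r ^+ K.+1]; the code space contains zero with
    both signs, which only enlarges it. *)
Lemma geometric_weight_sum_le1 (R : realType) (T : finType) (m : nat)
    (f : T -> 'I_m -> int) (r : R) :
  0 <= r <= 1 -> (forall x y, f x =1 f y -> x = y) ->
  \sum_x \prod_j ((1 - r) / 2 * r ^+ `|f x j|%N) <= 1.
Proof.
move=> /andP[r_ge0 r_le1] f_inj.
pose K := \max_x \max_j `|f x j|%N.
have f_le x j : (`|f x j| < K.+1)%N.
  rewrite ltnS; apply: leq_trans (leq_bigmax x).
  exact: (leq_bigmax (F := fun j => `|f x j|%N)).
pose g x : {ffun 'I_m -> bool * 'I_K.+1} :=
  [ffun j => (f x j < 0, inord `|f x j|%N)].
have g_inj : injective g.
  move=> x y /ffunP gxy; apply: f_inj => j.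
  have := gxy j; rewrite !ffunE => -[sgn_eq /(congr1 val)].
  rewrite /= !inordK// => abs_eq.
  by rewrite (intEsign (f x j)) (intEsign (f y j)) sgn_eq abs_eq.
pose F (p : bool * 'I_K.+1) : R := (1 - r) / 2 * r ^+ p.2.
have F_ge0 p : 0 <= F p.
  by rewrite mulr_ge0 ?exprn_ge0// divr_ge0// subr_ge0.
have sum_F : \sum_p F p = 1 - r ^+ K.+1.
  rewrite -(pair_bigA _ (fun b k => F (b, k))) big_bool /=.
  rewrite -!mulr_sumr -mulrDl -splitr -[RHS]opprB subrX1; ring.
have -> : \sum_x \prod_j ((1 - r) / 2 * r ^+ `|f x j|%N) =
          \sum_(h in [set g x | x in T]%SET) \prod_j F (h j).
  rewrite big_imset /=; last by move=> x y _ _; exact: g_inj.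
  apply: eq_bigr => x _; apply: eq_bigr => j _.
  by rewrite ffunE /F /= inordK.
apply: (@le_trans _ _ (\sum_(h : {ffun 'I_m -> bool * 'I_K.+1}) \prod_j F (h j))).
  rewrite [leRHS](bigID (mem [set g x | x in T]%SET)) /= lerDl.
  by apply: sumr_ge0 => h _; apply: prodr_ge0.
rewrite -(bigA_distr_bigA (fun _ => F)) /=; apply: prodr_ile1 => j _.
by rewrite sum_F gerBl exprn_ge0// subr_ge0 exprn_ile1.
Qed.

Lemma ln_card_lattice_points_le (R : realType) (T : finType) (m : nat)
    (f : T -> 'I_m -> int) (G : R) :
  (0 < m)%N -> 0 < G -> (forall x y, f x =1 f y -> x = y) ->
  \sum_x \sum_j `|(f x j)%:~R| <= #|T|%:R * G ->
  ln (#|T|%:R : R) <= m%:R * ln (2 * expR 1 * (G / m%:R + 1)).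
Proof.
move=> m_gt0 G_gt0 f_inj sum_f.
have [T0|T_gt0] := posnP #|T|.
  (* [ln 0] is 0 by convention, so the right-hand side only has to be nonnegative. *)
  rewrite T0 ln0// mulr_ge0// ln_ge0//.
  have := expR_ge1Dx (1 : R); have : 0 <= G / m%:R by rewrite divr_ge0// ltW.
  by nra.
have N_gt0 : 0 < #|T|%:R :> R by rewrite ltr0n.
have mR_gt0 : 0 < m%:R :> R by rewrite ltr0n.
pose mu := G / m%:R; have mu_gt0 : 0 < mu by rewrite divr_gt0.
have mu1_gt0 : 0 < 1 + mu by lra.
(* This [r] solves [r / (1 - r) = mu] and minimises [- ln ((1 - r) / 2) - mu * ln r], the bound per
   coordinate that comes from Gibbs' inequality. *)
pose r := mu / (1 + mu).
have r_gt0 : 0 < r by rewrite divr_gt0.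
have r_lt1 : r < 1 by rewrite ltr_pdivrMr//; lra.
have half_gt0 : 0 < (1 - r) / 2 by lra.
have r01 : 0 <= r <= 1 by rewrite !ltW.
pose q x := \prod_j ((1 - r) / 2 * r ^+ `|f x j|%N).
have q_gt0 x : 0 < q x.
  by apply: prodr_gt0 => j _; rewrite mulr_gt0// exprn_gt0.
have ln_q x : ln (q x) =
    m%:R * ln ((1 - r) / 2) + (\sum_j `|(f x j)%:~R|) * ln r.
  rewrite /q big_split prodr_const card_ord prodrXr /= lnM ?posrE ?exprn_gt0//.
  rewrite !lnXn// mulr_natl -[X in _ + X]mulr_natl natr_sum; congr (_ + _ * _).
  by apply: eq_bigr => j _; rewrite -intr_norm natr_absz.
have ln_half : ln ((1 - r) / 2) = - ln (2 * (1 + mu)).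
  rewrite -lnV ?posrE ?mulr_gt0//; congr ln; rewrite /r; field.
  by rewrite gt_eqF.
(* Hence [mu * - ln r <= 1]; this 1 per coordinate becomes the factor [expR 1] under the
   logarithm. *)
have ln_r : - ln r <= mu^-1.
  rewrite -lnV ?posrE//.
  have -> : r^-1 = 1 + mu^-1 by rewrite /r; field; rewrite !gt_eqF.
  by apply: le_ln1Dx; have : 0 < mu^-1 by [rewrite invr_gt0]; lra.
have := gibbs_uniform q_gt0 (geometric_weight_sum_le1 r01 f_inj).
under eq_bigr do rewrite ln_q.
rewrite big_split sumr_const -mulr_suml /= -(mulr_natl (_ * _)) ln_half => gibbs.
rewrite -(ler_pM2l N_gt0); apply: (le_trans gibbs).
have -> : 2 * expR 1 * (mu + 1) = expR 1 * (2 * (1 + mu)) :> R by ring.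
rewrite [ln (expR 1 * _)]lnM ?posrE ?expR_gt0 ?mulr_gt0// expRK.
have : (\sum_x \sum_j `|(f x j)%:~R|) * - ln r <= #|T|%:R * G * mu^-1.
  apply: ler_pM => //; last first.
    by rewrite oppr_ge0 ln_le0// ltW.
  by apply: sumr_ge0 => x _; apply: sumr_ge0 => j _.
have -> : #|T|%:R * G * mu^-1 = #|T|%:R * m%:R.
  by rewrite /mu; field; rewrite !gt_eqF.
lra.
Qed.

(** * Moments of random signed sums *)

Section RademacherSums.

Variables (R : realType) (s : nat) (a : 'I_s -> R).

Let flip (i : 'I_s) (e : {ffun 'I_s -> bool}) : {ffun 'I_s -> bool} :=
  [ffun k => (k == i) (+) e k].

(** For distinct indices, flipping the sign at [i] permutes the cube and negates every summand, so
    the sum equals its own opposite. *)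
Lemma sum_sign_product (i k : 'I_s) :
  \sum_(e : {ffun 'I_s -> bool}) (-1) ^+ e i * (-1) ^+ e k =
  (2 ^ s * (i == k))%:R :> R.
Proof.
have [<-|ik] := eqVneq i k.
  under eq_bigr do rewrite -expr2 sqrr_sign.
  by rewrite sumr_const card_ffun card_bool card_ord muln1.
set S := LHS; rewrite muln0.
have flip_inj : injective (flip i).
  move=> e e' /ffunP ee'; apply/ffunP => l.
  by have := ee' l; rewrite !ffunE => /addbI.
suff : S = - S by lra.
rewrite {1}/S (reindex_inj flip_inj) -sumrN /=; apply: eq_bigr => e _.
by rewrite !ffunE eqxx eq_sym (negbTE ik) /= signrN mulNr.
Qed.

Lemma sum_sqr_sign_sum :
  \sum_(e : {ffun 'I_s -> bool}) (\sum_i a i * (-1) ^+ e i) ^+ 2 =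
  (2 ^ s)%:R * \sum_i a i ^+ 2.
Proof.
under eq_bigr => e _ do rewrite expr2 mulr_suml.
rewrite exchange_big mulr_sumr /=; apply: eq_bigr => i _.
under eq_bigr => e _ do rewrite mulr_sumr.
rewrite exchange_big (bigD1 i)//= [X in _ + X]big1 ?addr0.
  under eq_bigr => e _ do rewrite mulrACA.
  by rewrite -mulr_sumr sum_sign_product eqxx muln1 mulrC expr2.
move=> k ki; under eq_bigr => e _ do rewrite mulrACA.
by rewrite -mulr_sumr sum_sign_product eq_sym (negbTE ki) muln0 mulr0.
Qed.

(** The first moment is bounded through the second: with [L] the square root,
    [2 * L * |S| <= S ^+ 2 + L ^+ 2] for every signed sum [S], and the right-hand sides average to
    [2 * L ^+ 2]. Dividing by [L] requires treating [L = 0] apart. *)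
Lemma sum_norm_sign_sum_le :
  \sum_(e : {ffun 'I_s -> bool}) `|\sum_i a i * (-1) ^+ e i| <=
  (2 ^ s)%:R * Num.sqrt (\sum_i a i ^+ 2).
Proof.
set L := Num.sqrt _.
have sum_ge0 : 0 <= \sum_i a i ^+ 2 by apply: sumr_ge0 => i _; exact: sqr_ge0.
have sqrL : L ^+ 2 = \sum_i a i ^+ 2 by rewrite sqr_sqrtr.
have [L0|L_neq0] := eqVneq L 0.
  rewrite L0 mulr0 big1// => e _; rewrite big1 ?normr0// => i _.
  suff -> : a i = 0 by rewrite mul0r.
  apply/eqP; rewrite -sqrf_eq0; move: sqrL; rewrite L0 expr0n => /esym/eqP.
  rewrite psumr_eq0 => [/allP/(_ i)|k _]; last exact: sqr_ge0.
  by rewrite mem_index_enum => /(_ isT).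
have L_gt0 : 0 < L by rewrite lt_neqAle eq_sym L_neq0 sqrtr_ge0.
rewrite -(ler_pM2l (mulr_gt0 (ltr0Sn R 1) L_gt0)) mulr_sumr.
apply: (@le_trans _ _ (\sum_(e : {ffun 'I_s -> bool})
    ((\sum_i a i * (-1) ^+ e i) ^+ 2 + L ^+ 2))).
  apply: ler_sum => e _; rewrite -[X in _ <= X + _]real_normK ?num_real//.
  have := sqr_ge0 (`|\sum_i a i * (-1) ^+ e i| - L); nra.
rewrite big_split /= sum_sqr_sign_sum sumr_const card_ffun card_bool card_ord.
rewrite -sqrL -(mulr_natl (L ^+ 2)); nra.
Qed.

End RademacherSums.

(** * Vertices of convex hulls and of the integer hull *)

Lemma sub_conv (R : realType) (n : nat) (X : set 'cV[R]_n) : X `<=` conv X.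
Proof.
move=> x Xx; exists 1%N, (fun _ => 1), (fun _ => x).
by split=> //; rewrite big_ord1 ?scale1r.
Qed.

(** If [v] were outside [X], the points of [X] representing it would all differ from [v], so they
    would place [v] in the hull of the remaining points. *)
Lemma vertex_conv_mem (R : realType) (n : nat) (X : set 'cV[R]_n) (v : 'cV[R]_n) :
  is_vertex (conv X) v -> X v.
Proof.
move=> [[k [c [y [c_ge0 sum_c Xy v_eq]]]]] not_conv.
apply: contrapT => nXv; apply: not_conv; exists k, c, y; split=> // i.
by split; [exact/sub_conv/Xy | move=> yv; apply: nXv; rewrite -yv].
Qed.

(** Otherwise [v] would be the midpoint of two points of [X] other than itself. *)
Lemma vertex_conv_shift_eq0 (R : realType) (n : nat) (X : set 'cV[R]_n)
    (v d : 'cV[R]_n) :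
  is_vertex (conv X) v -> X (v + d) -> X (v - d) -> d = 0.
Proof.
move=> [_ not_conv] Xp Xm; apply/eqP/negPn/negP => d_neq0; apply: not_conv.
exists 2%N, (fun _ => 2^-1), (fun i => if i == ord0 then v + d else v - d).
split=> [i|||]; rewrite ?big_ord_recl ?big_ord0 /=.
- by rewrite invr_ge0.
- by lra.
- move=> i; split; first by case: ifP => _; exact: sub_conv.
  rewrite /=; case: ifP => _ /eqP; rewrite -subr_eq0 addrAC subrr add0r;
  by rewrite ?oppr_eq0 (negbTE d_neq0).
- rewrite addr0 -scalerDr addrACA subrr addr0 -mulr2n -scaler_nat scalerA.
  by rewrite mulVf ?scale1r// pnatr_eq0.
Qed.

Lemma integer_point_shift (R : realType) (m n : nat) (A : 'M[int]_(m, n))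
    (b : 'cV[int]_m) (v d : 'cV[R]_n) :
  (polyhedron A b `&` @integer_points R n) v ->
  map_mx intr A *m d = 0 -> @integer_points R n d ->
  (forall k, `|d k ord0| <= v k ord0) ->
  (polyhedron A b `&` @integer_points R n) (v + d).
Proof.
move=> [[v_ge0 Av] v_int] Ad d_int d_le; split; first split.
- move=> k; rewrite mxE -lerBlDr sub0r.
  by apply: le_trans (d_le k); rewrite -normrN ler_norm.
- by rewrite mulmxDr Ad addr0.
- by move=> k; rewrite mxE rpredD.
Qed.

(* If two sign vectors had the same image, half their difference would be a
   kernel vector with entries in {-1, 0, 1} supported on supp v; the entries of
   v there are at least 1, so v could be moved along it in both directions. *)
Lemma vertex_sign_sums_inj (R : realType) (m n : nat) (A : 'M[int]_(m, n))
    (b : 'cV[int]_m) (v : 'cV[R]_n) (e e' : {ffun 'I_#|supp v| -> bool}) :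
  is_vertex (integer_hull A b) v ->
  (forall j, \sum_i colsubset A (supp v) j i * (-1) ^+ e i =
             \sum_i colsubset A (supp v) j i * (-1) ^+ e' i) ->
  e = e'.
Proof.
move=> hv sum_eq; have Xv := vertex_conv_mem hv; have [[v_ge0 Av] v_int] := Xv.
pose c i : R := ((-1) ^+ e i - (-1) ^+ e' i) / 2.
have c_eq i : [\/ c i = 0, c i = 1 | c i = -1].
  rewrite /c; case: (e i) (e' i) => [] [] /=; rewrite ?expr0 ?expr1.
  - by apply: Or31; lra.
  - by apply: Or33; lra.
  - by apply: Or32; lra.
  - by apply: Or31; lra.
pose d : 'cV[R]_n := \sum_i c i *: delta_mx (enum_val i) ord0.
have d_in i : d (enum_val i) ord0 = c i.
  rewrite summxE (bigD1 i)//= big1 => [|k ki]; rewrite !mxE !eqxx.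
    by rewrite mulr1 addr0.
  by rewrite (inj_eq enum_val_inj) eq_sym (negbTE ki) mulr0.
have d_out k : k \notin supp v -> d k ord0 = 0.
  move=> kv; rewrite summxE big1// => i _; rewrite !mxE.
  by case: eqP => [k_eq|]; rewrite ?mulr0//; rewrite k_eq enum_valP in kv.
have Ad : map_mx intr A *m d = 0.
  apply/colP => j; rewrite mulmx_sumr summxE mxE.
  (* The hypothesis is an equation in [int]; it is cast to [R] because [c] involves a division by
     2. *)
  have /(congr1 (intr : int -> R)) := sum_eq j; rewrite !rmorph_sum /= => eqR.
  have eq0 : (\sum_i (colsubset A (supp v) j i * (-1) ^+ e i)%:~R
      - \sum_i (colsubset A (supp v) j i * (-1) ^+ e' i)%:~R) / 2 = 0 :> R.
    by rewrite eqR subrr mul0r.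
  rewrite -[RHS]eq0 -sumrB mulr_suml; apply: eq_bigr => i _.
  by rewrite -scalemxAr -colE !mxE !intrM !intr_sign -mulrBr -mulrA mulrC.
have d_int : @integer_points R n d.
  move=> k; have [kv|/d_out ->] := boolP (k \in supp v); last exact: rpred0.
  rewrite -(enum_rankK_in kv kv) d_in.
  by case: (c_eq (enum_rank_in kv k)) => ->; rewrite ?rpredN ?rpred0 ?rpred1.
have d_le k : `|d k ord0| <= v k ord0.
  have [kv|/d_out ->] := boolP (k \in supp v); last by rewrite normr0.
  apply: (@le_trans _ _ 1).
    rewrite -(enum_rankK_in kv kv) d_in.
    by case: (c_eq (enum_rank_in kv k)) => ->; rewrite ?normrN ?normr0 ?normr1 ?ler01.
  move: kv; rewrite inE => vk; have := v_ge0 k; move: vk.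
  have /intrP[z ->] := v_int k; rewrite intr_eq0 ler0z ler1z => z0 zge0.
  by rewrite -gtz0_ge1 lt_neqAle eq_sym z0.
have d0 : d = 0.
  apply: (vertex_conv_shift_eq0 hv); apply: integer_point_shift => //.
  - by rewrite mulmxN Ad oppr0.
  - by move=> k; rewrite mxE rpredN.
  - by move=> k; rewrite mxE normrN.
apply/ffunP => i; have := d_in i; rewrite d0 mxE /c.
move=> /esym/eqP; rewrite mulf_eq0 invr_eq0 pnatr_eq0 orbF subr_eq0.
by rewrite (inj_eq signr_inj) => /eqP.
Qed.

(** * The support bound *)

Theorem theorem12 (R : realType) (m n : nat)
    (A : 'M[int]_(m, n)) (b : 'cV[int]_m) (v : 'cV[R]_n)
    (hv : is_vertex (integer_hull A b) v) :
  let s := #|supp v| in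
  let B : 'M[R]_(m, s) := map_mx intr (colsubset A (supp v)) in
  let Gamma : R :=
    112 / 100 * \sum_(j < m) norm2 (row j B)
    + Num.sqrt (\sum_(i < s) norm1 (col i B) ^+ 2) in
  let e : R := expR 1 in
  s%:R <= m%:R * log2 (2 * e * Gamma / m%:R + 2 * e).
Proof.
pose s := #|supp v|.
pose B : 'M[R]_(m, s) := map_mx intr (colsubset A (supp v)).
pose Gamma : R := 112 / 100 * \sum_(j < m) norm2 (row j B)
  + Num.sqrt (\sum_(i < s) norm1 (col i B) ^+ 2).
pose e : R := expR 1.
rewrite -[X in is_true X]/(s%:R <= m%:R * log2 (2 * e * Gamma / m%:R + 2 * e)).
have row_ge0 j : 0 <= norm2 (row j B) by exact: sqrtr_ge0.
(* [L] will bound the average 1-norm of [B x] over all sign vectors [x]. *)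
pose L := \sum_(j < m) norm2 (row j B).
have L_ge0 : 0 <= L by apply: sumr_ge0 => j _; exact: row_ge0.
have L_le : L <= Gamma.
  have := sqrtr_ge0 (\sum_(i < s) norm1 (col i B) ^+ 2); rewrite /Gamma -/L; lra.
have ln2_gt0 : 0 < ln 2 :> R by rewrite ln_gt0// ltr1n.
have e_ge1 : 1 <= e by have := expR_ge1Dx (1 : R); rewrite /e; lra.
have inj := @vertex_sign_sums_inj _ _ _ _ _ _ _ _ hv.
pose f (x : {ffun 'I_s -> bool}) j := \sum_i colsubset A (supp v) j i * (-1) ^+ x i.
(* If [s] is 0, then [m] may be 0 as well; division by zero yields 0, so the argument of the
   logarithm is still at least [2 * e]. *)
have [s0|s_gt0] := posnP s.
  rewrite s0 mulr_ge0// divr_ge0 ?(ltW ln2_gt0)// ln_ge0//.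
  have : 0 <= Gamma / m%:R by rewrite divr_ge0// (le_trans L_ge0).
  by rewrite -mulrA; nra.
(* Two distinct sign vectors must have distinct images, which rules out [m = 0] and, further on,
   [L = 0]. *)
have false_neq_true : [ffun=> false] <> [ffun=> true] :> {ffun 'I_s -> bool}.
  by move/ffunP/(_ (Ordinal s_gt0)); rewrite !ffunE.
have m_gt0 : (0 < m)%N.
  rewrite lt0n; apply/eqP => m0; apply: false_neq_true; apply: inj => j.
  by have := ltn_ord j; rewrite [X in (_ < X)%N]m0.
have norm_row j : norm2 (row j B) = Num.sqrt (\sum_i B j i ^+ 2).
  by rewrite /norm2 big_ord1; congr Num.sqrt; apply: eq_bigr => i _; rewrite mxE.
have fE x j : (f x j)%:~R = \sum_i B j i * (-1) ^+ x i :> R.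
  by rewrite rmorph_sum /=; apply: eq_bigr => i _; rewrite intrM intr_sign !mxE.
have sum_f : \sum_x \sum_j `|(f x j)%:~R : R| <= (2 ^ s)%:R * L.
  rewrite exchange_big mulr_sumr; apply: ler_sum => j _.
  rewrite norm_row; apply: le_trans (sum_norm_sign_sum_le (B j)).
  by apply: ler_sum => x _; rewrite fE.
have Gamma_gt0 : 0 < Gamma.
  rewrite (lt_le_trans _ L_le)// lt_neqAle L_ge0 andbT; apply/eqP => L0.
  (* If [L] vanishes, so does the sum of all the nonnegative terms in [sum_f], hence each single
     term. *)
  have f0 x j : f x j = 0.
    apply/eqP; rewrite -(intr_eq0 R) -normr_le0.
    apply: le_trans (le_trans sum_f _); last by rewrite -L0 mulr0.
    rewrite (bigD1 x)//= (bigD1 j)//= -addrA lerDl addr_ge0// sumr_ge0// => y _.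
    exact: sumr_ge0.
  by apply: false_neq_true; apply: inj => j; rewrite -!/(f _ j) !f0.
have card_cube : #|{ffun 'I_s -> bool}| = (2 ^ s)%N.
  by rewrite card_ffun card_bool card_ord.
have sum_fG : \sum_x \sum_j `|(f x j)%:~R| <= #|{ffun 'I_s -> bool}|%:R * Gamma.
  by rewrite card_cube (le_trans sum_f)// ler_wpM2l.
have := ln_card_lattice_points_le m_gt0 Gamma_gt0 inj sum_fG.
rewrite card_cube natrX lnXn// -(mulr_natl (ln 2)) => ln_le.
rewrite /log2 mulrA ler_pdivlMr//.
have -> : 2 * e * Gamma / m%:R + 2 * e = 2 * expR 1 * (Gamma / m%:R + 1).
  by rewrite /e; ring.
exact: ln_le.
Qed.
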